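(* Let $\Gamma\subset C^\infty(\Theta,\Lambda)$ be a compact finite-dimensional submanifold and let $\mathbf{y}=(y_1,\dots,y_k)\in\Lambda^k$. Assume that the loss function $\ell=\ell(\hat\gamma,\gamma)$ is a smooth function on $C^\infty(\Theta,\Lambda)\times C^\infty(\Theta,\Lambda)$. Then the posterior risk $\mathcal{R}(\hat\gamma|\mathbf{y})=\int_{\gamma\in\Gamma}\ell(\hat\gamma,\gamma)\,\lambda(\gamma|\mathbf{y})\,\mathrm{d}\gamma$ satisfies $$\frac{\partial}{\partial\hat\gamma}\mathcal{R}(\hat\gamma|\mathbf{y})=\int_{\gamma\in\Gamma}\frac{\partial\ell}{\partial\hat\gamma}\,\lambda(\gamma|\mathbf{y})\,\mathrm{d}\gamma .$$ If $\hat\gamma=g(\mathbf{y})$ is a Bayesian estimator, i.e. $\hat\gamma\in\Gamma$ minimizes $\mathcal{R}(\cdot|\mathbf{y})$ over $\Gamma$, then $$\frac{\partial}{\partial\hat\gamma}\mathcal{R}(\hat\gamma|\mathbf{y})\ \text{ lies in }\ \mathrm{N}_{\hat\gamma}\Gamma\subset T^*_{\hat\gamma}C^\infty(\Theta,\Lambda).$$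
   Context: $\Theta,\Lambda$ are smooth manifolds; $C^\infty(\Theta,\Lambda)$ is regarded as a Fréchet manifold whose tangent space at $\gamma$ consists of smooth sections of $\gamma^*T\Lambda$. Fixed design points $\theta_1,\dots,\theta_k\in\Theta$ are given; $f(\mathbf{y}|\gamma)=\prod_if(y_i|\gamma(\theta_i))$ is the conditional density of $\mathbf{y}$ given $\gamma$; $\mathrm{d}\gamma$ is a smooth volume form on $\Gamma$ and $\lambda(\gamma)\,\mathrm{d}\gamma$ is a Bayesian prior on $\Gamma$. The posterior density is $\lambda(\gamma|\mathbf{y})=f(\mathbf{y}|\gamma)\lambda(\gamma)/\mu(\mathbf{y})$ with $\mu(\mathbf{y})=\int_\Gamma f(\mathbf{y}|\gamma)\lambda(\gamma)\,\mathrm{d}\gamma$. A loss function satisfies: it is continuous and smooth a.e.; symmetric in its two arguments; non-negative, and zero iff the two arguments coincide; and its hessian is non-degenerate on the normal bundle to the diagonal. $\frac{\partial\ell}{\partial\hat\gamma}\in T^*_{\hat\gamma}C^\infty(\Theta,\Lambda)$ is the $1$-form obtained by fixing $\gamma$ and differentiating $\ell(\hat\gamma,\gamma)$ with respect to $\hat\gamma$. $\mathrm{N}_{\hat\gamma}\Gamma$ is the annihilator of $T_{\hat\gamma}\Gamma$ in $T^*_{\hat\gamma}C^\infty(\Theta,\Lambda)$. *)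

(* Defs.v *)
From HB Require Import structures.
From mathcomp Require Import all_boot all_order all_algebra.
From mathcomp Require Import all_classical all_reals all_analysis.

Set Implicit Arguments.
Unset Strict Implicit.
Unset Printing Implicit Defensive.

Import Order.TTheory GRing.Theory Num.Theory.
Import numFieldNormedType.Exports.

Local Open Scope classical_set_scope.
Local Open Scope ring_scope.

(* The limit defining ['D_v f x] in derive.v, which is only available between
   normed modules. *)
Definition is_gderive (R : realType) (E F : tvsType R) (f : E -> F) (x v : E)
    (df : F) :=
  (fun h : R => h^-1 *: (f (x + h *: v) - f x)) @ 0^' --> df.

Definition gderivable (R : realType) (E F : tvsType R) (f : E -> F) (x v : E) :=
  exists df, is_gderive f x v df.

Definition gderive (R : realType) (E F : tvsType R) (f : E -> F) (x v : E) : F :=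
  xget 0 [set df | is_gderive f x v df].

(* C^k maps in the sense of Bastiani, Hamilton and Milnor: [f] is C^(k+1) on
   the open set [U] if it is continuous, all its directional derivatives exist
   and Df : U x E -> F is C^k.  Between finite-dimensional spaces these are the
   usual C^k maps. *)
Fixpoint Ck (R : realType) (k : nat) :
    forall E F : tvsType R, set E -> (E -> F) -> Prop :=
  match k with
  | 0 => fun E F U f => forall x, U x -> {for x, continuous f}
  | k'.+1 => fun E F U f =>
      [/\ forall x, U x -> {for x, continuous f},
          forall x v, U x -> gderivable f x v
        & @Ck R k' (E * E)%type F [set p | U p.1]
            (fun p => gderive f p.1 p.2)]
  end.

Definition smooth_on (R : realType) (E F : tvsType R) (U : set E) (f : E -> F) :=
  forall k, Ck k U f.

(* A tvsType is locally convex.  The uniform structure it carries is not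
   required to be the translation-invariant one, so completeness is spelled out
   with sequences such that u_i - u_j --> 0 (enough, since the topology has
   countable bases of neighbourhoods). *)
Definition frechet_space (R : realType) (E : tvsType R) :=
  [/\ hausdorff_space E,
      exists B : nat -> set E, (forall i, nbhs 0 (B i)) /\
        (forall A, nbhs 0 A -> exists i, B i `<=` A)
    & forall u : nat -> E,
        (fun ij : nat * nat => u ij.1 - u ij.2) @ (\oo, \oo) --> (0 : E) ->
        exists e : E, u @ \oo --> e].

Record chart (R : realType) (M : ptopologicalType) (E : tvsType R) := Chart {
  cdom : set M;
  cmap :> M -> E;
  cinv : E -> M;
  cdom_open : open cdom;
  cran_open : open (cmap @` cdom);
  cmapK : forall x, cdom x -> cinv (cmap x) = x;
  cmap_continuous : forall x, cdom x -> {for x, continuous cmap};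
  cinv_continuous : forall x, cdom x -> {for cmap x, continuous cinv} }.

(* [chart_at x] is a preferred chart around [x]; it only serves to represent
   tangent vectors at [x] by elements of the model space. *)
Record manifold (R : realType) (E : tvsType R) := Manifold {
  msort :> ptopologicalType;
  mhausdorff : hausdorff_space msort;
  atlas : set (chart msort E);
  chart_at : msort -> chart msort E;
  chart_at_atlas : forall x, atlas (chart_at x);
  chart_at_dom : forall x, cdom (chart_at x) x;
  transition_smooth : forall phi psi, atlas phi -> atlas psi ->
    smooth_on (phi @` (cdom phi `&` cdom psi)) (psi \o cinv phi) }.

Record fd_manifold (R : realType) (n : nat) := FdManifold {
  fd_man :> manifold 'rV[R]_n;
  fd_second_countable : second_countable (T := fd_man) }.

Definition smooth_map (R : realType) (E1 E2 : tvsType R)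
    (M : manifold E1) (N : manifold E2) (f : M -> N) :=
  continuous f /\
  forall phi psi, atlas (m := M) phi -> atlas (m := N) psi ->
    smooth_on (phi @` (cdom phi `&` f @^-1` cdom psi))
              (psi \o f \o cinv phi).

(* smoothness on the product manifold, in product charts *)
Definition smooth_map2 (R : realType) (E1 E2 E3 : tvsType R)
    (M1 : manifold E1) (M2 : manifold E2) (N : manifold E3)
    (f : M1 -> M2 -> N) :=
  continuous (fun p : M1 * M2 => f p.1 p.2) /\
  forall phi1 phi2 psi, atlas (m := M1) phi1 -> atlas (m := M2) phi2 ->
    atlas (m := N) psi ->
    smooth_on [set (phi1 p.1, phi2 p.2) | p in
                 [set p | [/\ cdom phi1 p.1, cdom phi2 p.2
                            & cdom psi (f p.1 p.2)]]]
      (fun u : E1 * E2 => psi (f (cinv phi1 u.1) (cinv phi2 u.2))).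

Definition smooth_fun2 (R : realType) (E1 E2 : tvsType R)
    (M1 : manifold E1) (M2 : manifold E2)
    (f : M1 -> M2 -> R) :=
  continuous (fun p : M1 * M2 => f p.1 p.2 : R^o) /\
  forall phi1 phi2, atlas (m := M1) phi1 -> atlas (m := M2) phi2 ->
    smooth_on ((phi1 @` cdom phi1) `*` (phi2 @` cdom phi2))
      (fun u : E1 * E2 => f (cinv phi1 u.1) (cinv phi2 u.2) : R^o).

(* T_x M, in the coordinates of [chart_at x] *)
Definition tangent (R : realType) (E : tvsType R)
    (M : manifold E) (x : M) : tvsType R := E.

(* T*_x M: the topological dual of T_x M *)
Definition cotangent (R : realType) (E : tvsType R)
    (M : manifold E) (x : M) : set (tangent x -> R) :=
  [set a | (forall (c : R) u v, a (c *: u + v) = c * a u + a v) /\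
           continuous (a : tangent x -> R^o)].

Definition mdiff (R : realType) (E1 E2 : tvsType R)
    (M : manifold E1) (N : manifold E2) (f : M -> N) (x : M)
    (v : tangent x) : tangent (f x) :=
  gderive (chart_at (f x) \o f \o cinv (chart_at x)) (chart_at x x) v.

Definition differential (R : realType) (E : tvsType R)
    (M : manifold E) (f : M -> R) (x : M)
    (v : tangent x) : R :=
  gderive (F := R^o) (f \o cinv (chart_at x)) (chart_at x x) v.

(* the differential of [f] at [x] exists and is an element of T*_x M *)
Definition has_differential (R : realType) (E : tvsType R)
    (M : manifold E) (f : M -> R) (x : M) :=
  (forall v, gderivable (F := R^o) (f \o cinv (chart_at x)) (chart_at x x) v) /\
  cotangent (differential f (x := x)).

(* coordinates in the chart [psi] of the tangent vector [v] at [x] *)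
Definition tangent_coord (R : realType) (E : tvsType R)
    (M : manifold E) (psi : chart M E) (x : M)
    (v : tangent x) : E :=
  gderive (psi \o cinv (chart_at x)) (chart_at x x) v.

(* X is a smooth section of the pullback bundle gamma^* T Lambda *)
Definition smooth_section (R : realType) (E1 E2 : tvsType R)
    (Theta : manifold E1) (Lambda : manifold E2) (gamma : Theta -> Lambda)
    (X : forall t, tangent (gamma t)) :=
  forall phi psi, atlas (m := Theta) phi -> atlas (m := Lambda) psi ->
    smooth_on (phi @` (cdom phi `&` gamma @^-1` cdom psi))
      (fun u : E1 => tangent_coord psi (X (cinv phi u))).

(* C^oo(Theta, Lambda) as a Frechet manifold: the points are the smooth maps
   (through [mm_ev]), the smooth structure is the one for which the exponential
   law holds, and the tangent space at gamma is the space of smooth sections of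
   gamma^* T Lambda, a tangent vector v being identified with the section
   theta |-> d(ev_theta)(v).  The exponential law determines the smooth
   structure, hence (a Frechet topology being final for its smooth curves) the
   topology. *)
Record mapping_manifold (R : realType) (p q : nat)
    (Theta : fd_manifold R p) (Lambda : fd_manifold R q) (E : tvsType R) :=
  MappingManifold {
  mm_man :> manifold E;
  mm_frechet : frechet_space E;
  mm_ev : mm_man -> Theta -> Lambda;
  mm_ev_inj : injective mm_ev;
  mm_ev_range : range mm_ev = [set gamma | smooth_map gamma];
  mm_exponential_law : forall (m : nat) (N : fd_manifold R m) (c : N -> mm_man),
    smooth_map c <-> smooth_map2 (fun x => mm_ev (c x));
  mm_tangent : forall gamma : mm_man,
    (forall v : tangent gamma,
       smooth_section (fun t => mdiff (mm_ev^~ t) v)) /\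
    (forall X : (forall t, tangent (mm_ev gamma t)), smooth_section X ->
       exists! v : tangent gamma, forall t, mdiff (mm_ev^~ t) v = X t) }.

(* An (embedded) compact submanifold, given by its inclusion map; an injective
   immersion of a compact manifold is an embedding. *)
Record compact_submanifold (R : realType) (E : tvsType R) (M : manifold E)
    (n : nat) := CompactSubmanifold {
  sub_man :> fd_manifold R n;
  sub_compact : compact [set: sub_man];
  sub_incl : sub_man -> M;
  sub_incl_inj : injective sub_incl;
  sub_incl_smooth : smooth_map sub_incl;
  sub_incl_immersion : forall x : sub_man, injective (mdiff sub_incl (x := x)) }.

Section conormal.
Context {R : realType} {E : tvsType R} {M : manifold E} {n : nat}.
Variable G : compact_submanifold M n.

Definition sub_tangent (g : G) : set (tangent (sub_incl g)) :=
  range (mdiff (@sub_incl _ _ _ _ G) (x := g)).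

Definition conormal (g : G) : set (tangent (sub_incl g) -> R) :=
  [set a | cotangent a /\ forall v, sub_tangent v -> a v = 0].

End conormal.

Definition borel (T : ptopologicalType) := g_sigma_algebraType (@open T).

(* Lebesgue integral over R^n of a nonnegative Borel function, as an iterated
   integral *)
Fixpoint iintegral (R : realType) (n : nat) : ('rV[R]_n -> \bar R) -> \bar R :=
  match n with
  | 0 => fun h => h 0
  | n'.+1 => fun h =>
      (\int[lebesgue_measure]_(x in [set: R])
         iintegral (fun w : 'rV[R]_n' => h (row_mx (x%:M : 'rV[R]_1) w)))%E
  end.

(* A nowhere vanishing smooth n-form omega, which in the chart [phi] reads
   [vcoef phi] dx_1 /\ ... /\ dx_n, together with the Borel measure |omega| that
   it determines. *)
Record volume_form (R : realType) (n : nat) (G : fd_manifold R n) :=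
  VolumeForm {
  vcoef : chart G 'rV[R]_n -> 'rV[R]_n -> R;
  vcoef_smooth : forall phi, atlas (m := G) phi ->
    smooth_on (phi @` cdom phi) (vcoef phi : 'rV[R]_n -> R^o);
  vcoef_neq0 : forall phi, atlas (m := G) phi ->
    forall w, (phi @` cdom phi) w -> vcoef phi w != 0;
  vcoef_transition : forall phi psi, atlas (m := G) phi -> atlas (m := G) psi ->
    forall w, (phi @` (cdom phi `&` cdom psi)) w ->
      vcoef phi w = vcoef psi (psi (cinv phi w)) *
                    \det (jacobian (psi \o cinv phi) w);
  vmeasure : {measure set (borel G) -> \bar R};
  vmeasureE : forall phi, atlas (m := G) phi ->
    forall A : set (borel G), measurable A -> A `<=` cdom phi ->
      vmeasure A =
        iintegral (fun w => (`|vcoef phi w| * \1_(phi @` A) w)%:E) }.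

(* [f y x] is f(y|x), a density in y with respect to [dy] for each x. *)
Definition conditional_density (R : realType) (d : measure_display)
    (T : measurableType d) (dy : {measure set T -> \bar R}) (f : T -> T -> R) :=
  [/\ measurable_fun setT (fun p : T * T => f p.1 p.2),
      forall y x, 0 <= f y x
    & forall x, (\int[dy]_y (f y x)%:E = 1)%E].

Definition probability_density (R : realType) (d : measure_display)
    (T : measurableType d) (mu : {measure set T -> \bar R}) (h : T -> R) :=
  [/\ measurable_fun setT h, forall x, 0 <= h x & (\int[mu]_x (h x)%:E = 1)%E].

(* The Hessian at (x, x) of [l] on M x M, in the coordinates of [chart_at x].
   The bilinear form it induces on the normal space T(M x M) / T(diagonal) is
   non-degenerate iff a vector in its kernel is tangent to the diagonal. *)
Definition hessian_diag (R : realType) (E : tvsType R) (M : manifold E)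
    (l : M -> M -> R) (x : M) (u v : tangent x * tangent x) : R :=
  let L (z : E * E) : R^o :=
    l (cinv (chart_at x) z.1) (cinv (chart_at x) z.2) in
  gderive (F := R^o) (fun z => gderive L z u) (chart_at x x, chart_at x x) v.

Record loss_function (R : realType) (E : tvsType R) (M : manifold E)
    (l : M -> M -> R) : Prop := LossFunction {
  loss_continuous : continuous (fun p : M * M => l p.1 p.2 : R^o);
  loss_sym : forall x y, l x y = l y x;
  loss_ge0 : forall x y, 0 <= l x y;
  loss_eq0 : forall x y, l x y = 0 <-> x = y;
  loss_hessian : forall (x : M) (u : tangent x * tangent x),
    (forall v, hessian_diag l u v = 0) -> u.1 = u.2 }.

Section bayes.
Context {R : realType} {p q n k : nat}.
Context {Theta : fd_manifold R p} {Lambda : fd_manifold R q} {E : tvsType R}.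
Variable C : mapping_manifold Theta Lambda E.
Variables (G : compact_submanifold C n) (dg : volume_form G).
Variables (f : Lambda -> Lambda -> R) (theta : 'I_k -> Theta).
Variables (lambda : G -> R) (l : C -> C -> R) (y : 'I_k -> Lambda).

Definition likelihood (g : G) : R :=
  \prod_(i < k) f (y i) (mm_ev (sub_incl g) (theta i)).

Definition marginal : \bar R :=
  (\int[vmeasure dg]_g (likelihood g * lambda g)%:E)%E.

Definition posterior (g : G) : R :=
  likelihood g * lambda g / fine marginal.

Definition posterior_risk (gh : C) : R :=
  \int[vmeasure dg]_g (l gh (sub_incl g) * posterior g).

Definition bayesian_estimate (gh : G) :=
  forall g : G, posterior_risk (sub_incl gh) <= posterior_risk (sub_incl g).

End bayes.

(* Main.v *)
Require Import Defs.
From mathcomp Require Import all_boot all_order all_algebra.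
From mathcomp Require Import all_classical all_reals all_analysis.
From mathcomp Require Import ring lra measurable_realfun.

Import Order.TTheory GRing.Theory Num.Theory.
Import numFieldNormedType.Exports.

Local Open Scope classical_set_scope.
Local Open Scope ring_scope.

(** The loss [l gh (sub_incl g)] is a family of functions of [gh] indexed by the
    compact manifold [G].  In a chart around [gh] each member has directional
    derivatives, and these depend continuously on the base point, the direction
    and the index together ([partial_continuous]).  Compactness of [G] makes the
    continuity in the base point and the direction uniform in the index, and by
    the mean value theorem the difference quotients then converge uniformly in
    the index ([equi_partial]).  Uniform convergence passes through the integral
    against the posterior, because the posterior is integrable, bounded or not
    ([Rintegral_strict_gderive]).

    What is passed through the integral is not the bare directional derivative
    but a strict one ([equi_strict_gderive]): the first order expansion holds
    uniformly for base points and directions close to the given ones.  On a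
    topological vector space without a norm this is the notion that retains what
    a C^1 function gives: strict derivatives in all directions at one point are
    automatically linear and continuous in the direction, hence form a covector,
    and they obey the chain rule along any curve with a velocity.  So everything
    about the differential of the risk at [gh] follows from its strict derivatives
    at that single point.

    If [gh] minimizes the risk over [G], then along the image in the chart of a
    line through [gh] in a chart of [G], the risk has a minimum at time 0, so its
    derivative vanishes there; by the chain rule this derivative is the value of
    the differential on the corresponding tangent vector of [G]
    ([strict_gderive_min_conormal]). *)

(** * Directional derivatives of real functions *)

Section calculus.
Context {R : realType} {E : tvsType R}.
Implicit Types (F : E -> R^o) (u v w : E).

Lemma is_gderive_unique {F u v} {a b : R^o} :
  is_gderive F u v a -> is_gderive F u v b -> a = b.
Proof. by move=> Fa Fb; exact: (cvg_unique _ Fa Fb). Qed.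

Lemma gderiveE {F u v} {a : R^o} : is_gderive F u v a -> gderive F u v = a.
Proof.
by move=> Fa; apply: xget_unique => // b Fb; exact: is_gderive_unique Fb Fa.
Qed.

Lemma is_gderiveZ (c : R) {F u v} {a : R} :
  is_gderive F u v a -> is_gderive F u (c *: v) (c * a).
Proof.
move=> Fa; have [->|c0] := eqVneq c 0.
  rewrite mul0r /is_gderive.
  under eq_fun do rewrite scale0r scaler0 addr0 subrr scaler0.
  exact: cvg_cst.
pose q (k : R) : R := k^-1 *: (F (u + k *: v) - F u).
suff : c * q (h * c) @[h --> 0^'] --> c * a.
  suff -> : (fun h : R => c * q (h * c)) =
    (fun h : R => h^-1 *: (F (u + h *: (c *: v)) - F u)) by [].
  apply/funext => h; rewrite /q scalerA /GRing.scale/= invfM mulrA.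
  by rewrite (mulrC c) -(mulrA h^-1) mulVf// mulr1.
apply: cvgMl_tmp; apply: (@cvg_comp _ _ _ (fun h : R => h * c) q 0^' 0^') => //.
have := @continuous_injective_withinNx R R (fun h => h * c) 0.
rewrite mul0r; apply; first exact: mulrr_continuous.
by move=> h /eqP; rewrite mulf_eq0 (negPf c0) orbF => /eqP.
Qed.

(** A function of a point along a segment is a function of one real variable;
    the increment [h] is kept apart from the direction [v] so that the direction
    of the derivative stays close to a fixed one when [h] tends to 0. *)
Lemma MVT_gderive F u v (h : R) (d : E -> R) :
  (forall s : R, s \in `[0, 1] ->
     is_gderive F (u + (s * h) *: v) v (d (u + (s * h) *: v))) ->
  exists2 s, s \in `[0, 1]
    & F (u + h *: v) - F u = h * d (u + (s * h) *: v).
Proof.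
move=> Fd; pose phi (s : R) : R := F (u + (s * h) *: v).
have phid (s : R) : s \in `[0, 1]%R -> is_derive s 1 phi (h * d (u + (s * h) *: v)).
  move=> /Fd /(is_gderiveZ h) Fs.
  suff phis : (fun k : R => k^-1 *: (phi (k *: 1 + s) - phi s)) @ 0^' -->
      h * d (u + (s * h) *: v).
    apply: DeriveDef; first exact: cvgP phis.
    exact: cvg_lim phis.
  suff -> : (fun k : R => k^-1 *: (phi (k *: 1 + s) - phi s)) =
    (fun k => k^-1 *: (F (u + (s * h) *: v + k *: (h *: v)) - F (u + (s * h) *: v))) by [].
  apply/funext => k; rewrite /phi; congr (_ *: (F _ - _)).
  rewrite scalerA -addrA -scalerDl; congr (_ + _ *: _).
  by rewrite /GRing.scale/=; ring.
have phi_oo (s : R) : s \in `]0, 1[%R ->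
    is_derive s 1 phi (h * d (u + (s * h) *: v)).
  by move=> s01; apply: phid; apply: subset_itv_oo_cc s01.
have phi_cont : {within `[0, 1], continuous phi}.
  by apply: derivable_within_continuous => s s01; have [] := phid _ s01.
have [s s01 Fs] := MVT_segment ler01 phi_oo phi_cont.
exists s => //.
by move: Fs; rewrite /phi mul1r mul0r scale0r addr0 subr0 mulr1.
Qed.

Lemma tvs_cvgD {X : Type} {G : set_system X} {FG : Filter G} {f g : X -> E}
    {u v} : f @ G --> u -> g @ G --> v -> f x + g x @[x --> G] --> u + v.
Proof.
move=> fu gv.
exact: (continuous2_cvg _ (@add_continuous E (u, v)) fu gv).
Qed.

Lemma tvs_cvgZ {X : Type} {G : set_system X} {FG : Filter G} {h : X -> R}
    {f : X -> E} {c : R} {u} :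
  h @ G --> c -> f @ G --> u -> h x *: f x @[x --> G] --> c *: u.
Proof.
move=> hc fu.
exact: (continuous2_cvg _ (@scale_continuous _ E (c, u)) hc fu).
Qed.

Lemma cvg_shift (u v : E) :
  (p.1.1 + p.1.2 *: p.2) @[p --> ((u, (0 : R)), v)] --> u.
Proof.
set G := nbhs ((u, (0 : R)), v).
have Gx : p.1.1 @[p --> G] --> u.
  exact: (@cvg_comp _ _ _ fst fst G _ _ cvg_fst cvg_fst).
have Gh : p.1.2 @[p --> G] --> (0 : R).
  exact: (@cvg_comp _ _ _ fst snd G _ _ cvg_fst cvg_snd).
have Gv : p.2 @[p --> G] --> v by exact: cvg_snd.
have := tvs_cvgD Gx (tvs_cvgZ Gh Gv).
by rewrite scale0r addr0; apply; exact: nbhs_filter.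
Qed.

Lemma cvg_line (u v : E) : u + h *: v @[h --> (0 : R)] --> u.
Proof.
have id0 : h @[h --> (0 : R)] --> (0 : R) by exact: cvg_id.
have := tvs_cvgD (cvg_cst u) (tvs_cvgZ id0 (cvg_cst v)).
by rewrite scale0r addr0; apply; exact: nbhs_filter.
Qed.

(** The filter of triples (base point, time, direction) tending to [(u, 0, v)]
    has a basis of sets that are balanced in the time variable: what holds
    eventually holds along the whole segment that the mean value theorem
    explores. *)
Lemma near_segment (u v : E) (P : E -> R -> E -> Prop) :
  (\forall p \near ((u, (0 : R)), v), P p.1.1 p.1.2 p.2) ->
  \forall p \near ((u, (0 : R)), v),
    forall s : R, s \in `[0, 1] -> P p.1.1 (s * p.1.2) p.2.
Proof.
case=> -[/= A B] [[[A1 A2] [/= HA1 /nbhs_ballP[r r0 HA2]] HA] HB] HP.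
exists ((A1 `*` ball (0:R) r), B) => /=.
  split => //; exists (A1, ball (0 : R) r) => //; split => //=.
  exact: nbhsx_ballx.
move=> [[x h] w] [[/= A1x hr] Bw] s; rewrite in_itv/= => /andP[s0 s1].
apply: (HP ((x, s * h), w)); split => //=; apply: HA; split => //=; apply: HA2.
move: hr; rewrite -!ball_normE/= !sub0r !normrN => hr.
by rewrite normrM (le_lt_trans _ hr)// (ger0_norm s0) ler_piMl.
Qed.

(** * Strict directional derivatives *)

(** The directional counterpart of strict differentiability.  In
    [p = ((x, h), w)], a base point [x] that varies gives additivity in the
    direction, a direction [w] that varies gives continuity and the chain rule,
    and uniformity in [t] lets the derivative pass through an integral over
    [t]. *)
Definition equi_strict_gderive {T : Type} (F : T -> E -> R) u v (d : T -> R) :=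
  forall eps : R, 0 < eps -> \forall p \near ((u, (0 : R)), v), forall t,
    `|F t (p.1.1 + p.1.2 *: p.2) - F t p.1.1 - p.1.2 * d t| <= eps * `|p.1.2|.

Definition strict_gderive F u v (d : R) :=
  equi_strict_gderive (fun _ : unit => F) u v (fun=> d).

(** By the mean value theorem the remainder over a segment is the time multiplied
    by [D t y w - D t u v], where [y] lies on the segment; [near_segment] keeps
    [(y, w)] in the region where this difference is uniformly small. *)
Lemma equi_strict_gderive_C1 {T : Type} {F : T -> E -> R} {D : T -> E -> E -> R}
    {u v} :
  (\forall x \near u, forall t w, is_gderive (F t : E -> R^o) x w (D t x w)) ->
  (forall eps : R, 0 < eps -> \forall p \near (u, v), forall t,
     `|D t p.1 p.2 - D t u v| <= eps) ->
  equi_strict_gderive F u v (fun t => D t u v).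
Proof.
move=> FD Dcont eps eps0.
pose P (x : E) (h : R) (w : E) :=
  (forall t, is_gderive (F t : E -> R^o) (x + h *: w) w (D t (x + h *: w) w)) /\
  (forall t, `|D t (x + h *: w) w - D t u v| <= eps).
have : \forall p \near ((u, (0 : R)), v), P p.1.1 p.1.2 p.2.
  have shift := cvg_shift u v.
  have shift2 : (p.1.1 + p.1.2 *: p.2, p.2) @[p --> ((u, (0 : R)), v)]
      --> (u, v) by apply: cvg_pair => //=; exact: cvg_snd.
  near=> p; split; last by near: p; exact: (shift2 _ (Dcont _ eps0)).
  move=> t.
  have : forall t w, is_gderive (F t : E -> R^o) (p.1.1 + p.1.2 *: p.2) w
    (D t (p.1.1 + p.1.2 *: p.2) w) by near: p; exact: (shift _ FD).
  by [].
move=> /near_segment; apply: filterS => -[[x h] w] /= xhw t.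
have [|s s01 ->] := @MVT_gderive (F t) x w h (fun z => D t z w).
  by move=> s /xhw[].
by rewrite -mulrBr normrM mulrC ler_wpM2r//; have [_] := xhw _ s01.
Unshelve. all: by end_near. Qed.

(** A form without division by the time, comparable with the definition of the
    strict derivative. *)
Lemma is_gderiveP {F u v} {a : R} :
  is_gderive F u v a <-> forall eps : R, 0 < eps -> \forall h \near 0^',
    `|F (u + h *: v) - F u - h * a| <= eps * `|h|.
Proof.
have E0 (h : R) : h != 0 -> F (u + h *: v) - F u - h * a =
    - (h * (a - h^-1 *: (F (u + h *: v) - F u))).
  by move=> h0; rewrite /GRing.scale/= mulrBr mulVKf// opprB.
split=> [/cvgrPdist_le Fa eps eps0|Fa].
  have := Fa _ eps0; apply: filterS2 (nbhs_dnbhs_neq (0 : R)) => h h0 Fh.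
  by rewrite E0// normrN normrM mulrC ler_wpM2r.
apply/cvgrPdist_le => eps eps0; have := Fa _ eps0.
apply: filterS2 (nbhs_dnbhs_neq (0 : R)) => h h0.
by rewrite E0// normrN normrM mulrC ler_pM2r ?normr_gt0.
Qed.

End calculus.

Section strict_derivative.
Context {R : realType} {E : tvsType R} {F : E -> R^o} {u : E}.

Lemma near_shift {v : E} {P : E * R * E -> Prop} {x : R -> E} {h : R -> R}
    {w : R -> E} :
  (\forall p \near ((u, (0 : R)), v), P p) ->
  x @ 0^' --> u -> h @ 0^' --> 0 -> w @ 0^' --> v ->
  \forall k \near 0^', P ((x k, h k), w k).
Proof. by move=> nP xu h0 wv; exact: (cvg_pair (cvg_pair xu h0) wv). Qed.

Lemma cvg_id_dnbhs0 : h @[h --> (0 : R)^'] --> (0 : R).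
Proof. exact: cvg_within. Qed.

Lemma cvg_cst_dnbhs0 (v : E) : v @[_ --> (0 : R)^'] --> v.
Proof. exact: cvg_cst. Qed.

(** A curve with velocity [v] is, at time [h], the base point moved by [h] along
    the secant direction, which tends to [v]; this is why the direction is allowed
    to vary in a strict derivative. *)
Lemma strict_gderive_comp {X : tvsType R} {c : X -> E} {x w : X} {v : E}
    {a : R} :
  c x = u -> strict_gderive F u v a -> is_gderive c x w v ->
  is_gderive (F \o c : X -> R^o) x w a.
Proof.
move=> cx Fa cv; apply/is_gderiveP => eps eps0.
have /= := near_shift (Fa _ eps0) (cvg_cst_dnbhs0 _) cvg_id_dnbhs0 cv.
apply: filterS2 (nbhs_dnbhs_neq (0 : R)) => h h0 /(_ tt).
by rewrite scalerA mulfV// scale1r cx (addrC u) subrK.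
Qed.

Lemma strict_gderive_is_gderive {v a} :
  strict_gderive F u v a -> is_gderive F u v a.
Proof.
move=> Fa; apply/is_gderiveP => eps eps0.
have /= := near_shift (Fa _ eps0) (cvg_cst_dnbhs0 _) cvg_id_dnbhs0 (cvg_cst_dnbhs0 _).
by apply: filterS => h /(_ tt).
Qed.

(** Move from [u] first along [w], then along [c *: v].  The second move starts
    from [u + h *: w], so additivity uses that the base point may vary. *)
Lemma strict_gderive_linear {v w a b} (c : R) :
  strict_gderive F u v a -> strict_gderive F u w b ->
  is_gderive F u (c *: v + w) (c * a + b).
Proof.
move=> Fa Fb; apply/is_gderiveP => eps eps0.
(* the two moves last [h] and [h * c], so the errors add up to this factor *)
have c0 : 0 < 1 + `|c| by rewrite ltr_wpDr.
have e0 : 0 < eps / (1 + `|c|) by rewrite divr_gt0.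
have hw : u + h *: w @[h --> (0 : R)^'] --> u.
  exact: cvg_within_filter (cvg_line u w).
have hc : h * c @[h --> (0 : R)^'] --> (0 : R).
  by rewrite -[X in _ --> X](mul0r c); exact: (cvgMr_tmp cvg_id_dnbhs0).
have /= A := near_shift (Fa _ e0) hw hc (cvg_cst_dnbhs0 _).
have /= B := near_shift (Fb _ e0) (cvg_cst_dnbhs0 _) cvg_id_dnbhs0 (cvg_cst_dnbhs0 _).
apply: filterS2 A B => h /(_ tt) A /(_ tt) B.
rewrite scalerDr scalerA addrCA addrC (_ : F _ - _ - _ =
  (F (u + h *: w + (h * c) *: v) - F (u + h *: w) - h * c * a) +
  (F (u + h *: w) - F u - h * b)); last ring.
rewrite (le_trans (ler_normD _ _))// (le_trans (lerD A B))//.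
rewrite normrM le_eqVlt; apply/orP; left; apply/eqP; field.
by rewrite gt_eqF.
Qed.

(** For [w] near [v], the expansion along [v] also approximates the increments
    along [w], whose slope at small times is [d w]; so [d w] is near [d v]. *)
Lemma strict_gderive_continuous {d : E -> R^o} :
  (forall v, strict_gderive F u v (d v)) -> continuous d.
Proof.
move=> Fd v; apply/cvgrPdist_le => eps eps0.
have e2 : 0 < eps / 2 by rewrite divr_gt0.
have [[/= A B] [/= [[A1 A2] [/= uA1 A20] A12] Bv] ABP] := Fd v _ e2.
apply: filterS Bv => w Bw.
have /is_gderiveP/(_ _ e2) dw := strict_gderive_is_gderive (Fd w).
have /filter_ex [h [h0 A2h {}dw]] : \forall h \near (0 : R)^',
    [/\ h != 0, A2 h & `|F (u + h *: w) - F u - h * d w| <= eps / 2 * `|h| ].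
  apply: filterS3 (nbhs_dnbhs_neq (0 : R)) (nbhs_dnbhs A20) dw => //.
have /ABP/(_ tt)/= dv : (A `*` B) ((u, h), w).
  by split => //=; apply: A12; split => //=; exact: nbhs_singleton uA1.
rewrite -(@ler_pM2r _ `|h|) ?normr_gt0// -normrM.
rewrite (_ : _ * h = (F (u + h *: w) - F u - h * d w) -
  (F (u + h *: w) - F u - h * d v)); last ring.
rewrite (le_trans (ler_normB _ _))// (splitr eps) mulrDl.
by rewrite lerD.
Qed.

Lemma is_gderive_min {v : E} {a : R} :
  is_gderive F u v a -> (\forall h \near (0 : R), F u <= F (u + h *: v)) ->
  a = 0.
Proof.
move=> /is_gderiveP Fa Fmin; apply/eqP; apply: contraT => a0.
have a2 : 0 < `|a| / 2 by rewrite divr_gt0// normr_gt0.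
have Fa2 : \forall h \near (0 : R), h != 0 ->
  `|F (u + h *: v) - F u - h * a| <= `|a| / 2 * `|h| := Fa _ a2.
have /nbhs_ballP[r /= r0 rP] : \forall h \near (0 : R), (h != 0 ->
    `|F (u + h *: v) - F u - h * a| <= `|a| / 2 * `|h|) /\
    F u <= F (u + h *: v) by exact: filterI Fa2 Fmin.
(* at the times [r / 2] and [- (r / 2)], this bounds [- a] and [a] by [`|a| / 2] *)
have slope (h : R) : h != 0 -> `|h| < r -> - (h * a) <= `|a| / 2 * `|h|.
  move=> h0 hr; have [] := rP h; first by rewrite -ball_normE/= sub0r normrN.
  move=> /(_ h0) Fh Fuh; rewrite (le_trans _ Fh)// (le_trans _ (ler_norm _))//.
  by rewrite lerDr subr_ge0.
have r2 : 0 < r / 2 by rewrite divr_gt0.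
have r2r : `|r / 2| < r by rewrite gtr0_norm// ltr_pdivrMr// ltr_pMr// ltr1n.
have := slope (r / 2); rewrite gt_eqF// => /(_ isT r2r).
have := slope (- (r / 2)); rewrite oppr_eq0 gt_eqF// normrN => /(_ isT r2r).
rewrite (gtr0_norm r2); move: r2; set b := r / 2 => b0.
have : 0 < `|a| by rewrite normr_gt0.
case: (ler0P a) => _ /(mulr_gt0 b0) ab0 slopeN slopeP; exfalso; lra.
Qed.

End strict_derivative.

(** * Integrals over a compact space against an integrable weight *)

Lemma continuous_borel (S T : ptopologicalType) (f : S -> T) :
  continuous f -> measurable_fun setT (f : borel S -> borel T).
Proof.
move=> /continuousP cf.
apply: (@measurability _ _ (borel S) (borel T) setT f (@open T) erefl).
by move=> _ [A oA <-]; rewrite setTI; apply: sub_sigma_algebra; exact: cf.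
Qed.

Lemma continuous_borel_real (R : realType) (S : ptopologicalType) (f : S -> R) :
  continuous f -> measurable_fun setT (f : borel S -> R).
Proof.
move=> /continuousP cf.
apply: (measurability _ (RGenOpens.measurableE R)).
move=> _ [_ [a [b ->]] <-]; rewrite setTI; apply: sub_sigma_algebra.
exact/cf/interval_open.
Qed.

Section compact_integral.
Context {R : realType} {S : ptopologicalType}.
Context {mu : {measure set (borel S) -> \bar R}} {w : S -> R}.
Hypothesis S_compact : compact [set: S].
Hypothesis w_int : mu.-integrable setT (fun s => (w s)%:E).

Lemma integrable_continuousM {f : S -> R} :
  continuous f -> mu.-integrable setT (fun s => (f s * w s)%:E).
Proof.
move=> cf.
have fb : [bounded f s | s in [set: S]].
  have /compact_bounded : compact (f @` [set: S]).
    by apply: continuous_compact => //; exact: continuous_subspaceT.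
  move=> [M [Mreal fM]]; exists M; split => // N MN s _.
  by apply: (fM N MN); exists s.
exact: (@integrableMr _ (borel S) R mu setT measurableT f _
  (continuous_borel_real _ _ _ cf) fb w_int).
Qed.

Hypothesis w_ge0 : forall s, 0 <= w s.

(** The remainder of the integral is the integral of the remainders, and these are
    bounded by the weight times one multiple of the time for all indices, so the
    total error is at most that multiple of the mass of the weight. *)
Lemma Rintegral_strict_gderive {E : tvsType R} {F : S -> E -> R} {u v : E}
    {d : S -> R} :
  (forall x, continuous (F^~ x)) -> continuous d ->
  equi_strict_gderive F u v d ->
  strict_gderive (fun x => \int[mu]_s (F s x * w s)) u v
    (\int[mu]_s (d s * w s)).
Proof.
move=> cF cd Fd eps eps0.
(* [W + 1] rather than [W], which may vanish *)
set W := \int[mu]_s w s.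
have W0 : 0 <= W by apply: Rintegral_ge0 => s _; exact: w_ge0.
have W1 : 0 < W + 1 by rewrite ltr_wpDl.
apply: filterS (Fd _ (divr_gt0 eps0 W1)) => -[[x h] z]/= {}Fd _.
set y := x + h *: z in Fd *.
set e := eps / (W + 1) * `|h| in Fd.
have iF a := integrable_continuousM (cF a).
have id' := integrable_continuousM cd.
have iB : mu.-integrable setT (EFin \o (fun s => F s y * w s - F s x * w s)).
  by rewrite (_ : _ \o _ = (fun s => (F s y * w s)%:E - (F s x * w s)%:E)%E)//;
    apply: integrableB.
have iD : mu.-integrable setT (EFin \o (fun s => h * (d s * w s))).
  by rewrite (_ : _ \o _ = (fun s => h%:E * (d s * w s)%:E)%E)//;
    apply: integrableZl.
have iA : mu.-integrable setT (EFin \o (fun s =>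
    F s y * w s - F s x * w s - h * (d s * w s))).
  by rewrite (_ : _ \o _ = (fun s => (F s y * w s - F s x * w s)%:E -
    (h * (d s * w s))%:E)%E)//; apply: integrableB.
have ie : mu.-integrable setT (EFin \o (fun s => e * w s)).
  by rewrite (_ : _ \o _ = (fun s => e%:E * (w s)%:E)%E)//;
    apply: integrableZl.
rewrite -(RintegralB measurableT (iF y) (iF x)).
rewrite -(RintegralZl h measurableT id').
rewrite -(RintegralB measurableT iB iD).
rewrite (le_trans (le_normr_Rintegral _ _))//.
apply: (@le_trans _ _ (\int[mu]_s (e * w s))).
  apply: le_Rintegral => //; first exact: integrable_norm iA.
  move=> s _; rewrite mulrA -!mulrBl normrM (ger0_norm (w_ge0 s)).
  by rewrite ler_wpM2r.
rewrite RintegralZl// -/W /e mulrAC ler_wpM2r// mulrAC.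
by rewrite ler_pdivrMr// ler_wpM2l ?(ltW eps0)// lerDl.
Qed.

End compact_integral.

(** * Partial derivatives of a smooth function on a product *)

Section partial_differential.
Context {R : realType} {E1 E2 : tvsType R}.
Context {M1 : manifold E1} {M2 : manifold E2} {l : M1 -> M2 -> R}.
Hypothesis l_smooth : smooth_fun2 l.
Context {phi : chart M1 E1} {S : ptopologicalType} {s : S -> M2}.
Hypothesis phi_atlas : atlas (m := M1) phi.
Hypothesis s_continuous : continuous s.

Let L (psi : chart M2 E2) (z : E1 * E2) : R^o :=
  l (cinv phi z.1) (cinv psi z.2).

Let F (m : M2) (u : E1) : R^o := l (cinv phi u) m.

Let D (m : M2) (u v : E1) : R := gderive (F m) u v.

(** The partial derivative in the first variable is the derivative of the
    coordinate expression [L psi] along [(v, 0)], whatever the chart [psi] in the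
    second variable. *)
Lemma is_gderive_slice (psi : chart M2 E2) (m : M2) (u v : E1) :
  atlas (m := M2) psi -> cdom psi m -> (phi @` cdom phi) u ->
  is_gderive (F m) u v (gderive (L psi) (u, psi m) (v, 0)).
Proof.
move=> psi_atlas psim phiu.
have [_ /(_ phi psi phi_atlas psi_atlas 1%N) [_ Lder _]] := l_smooth.
have [|df Ldf] := Lder (u, psi m) (v, 0).
  by split => //=; exists m.
rewrite (gderiveE Ldf); move: Ldf; rewrite /is_gderive.
rewrite (_ : (fun h : R => _) =
  (fun h : R => h^-1 *: (F m (u + h *: v) - F m u)))//.
by apply/funext => h; rewrite /F/= scaler0 addr0 cmapK.
Qed.

Lemma is_gderive_partial (m : M2) (u v : E1) :
  (phi @` cdom phi) u -> is_gderive (F m) u v (D m u v).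
Proof.
move=> phiu; have := is_gderive_slice (chart_at m) m u v
  (chart_at_atlas m) (chart_at_dom m) phiu.
by move=> Fm; rewrite /D (gderiveE Fm).
Qed.

(** Only a chart [psi] around [s s0] is available, so joint continuity is first
    read off for [L psi], and transferred to the chart-free [D] on the region
    where [s] takes its values in the domain of [psi]. *)
Lemma partial_continuous (s0 : S) (u0 v0 : E1) : (phi @` cdom phi) u0 ->
  D (s q.1) q.2.1 q.2.2 @[q --> (s0, (u0, v0))] --> D (s s0) u0 v0.
Proof.
move=> phiu0; pose psi := chart_at (s s0).
have psi_atlas : atlas psi := chart_at_atlas (s s0).
have psis0 : cdom psi (s s0) := chart_at_dom (s s0).
have [_ /(_ phi psi phi_atlas psi_atlas 1%N) [_ _ Lcont]] := l_smooth.
have {}Lcont := Lcont ((u0, psi (s s0)), (v0, 0)).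
rewrite /D (gderiveE (is_gderive_slice psi (s s0) u0 v0 psi_atlas psis0 phiu0)).
set G := nbhs (s0, (u0, v0)).
have Gs : s q.1 @[q --> G] --> s s0.
  exact: (@cvg_comp _ _ _ fst s G _ _ cvg_fst (s_continuous s0)).
have Gu : q.2.1 @[q --> G] --> u0.
  exact: (@cvg_comp _ _ _ snd fst G _ _ cvg_snd cvg_fst).
have Gv : q.2.2 @[q --> G] --> v0.
  exact: (@cvg_comp _ _ _ snd snd G _ _ cvg_snd cvg_snd).
have Gpsi : psi (s q.1) @[q --> G] --> psi (s s0).
  exact: (@cvg_comp _ _ _ _ psi G _ _ Gs (cmap_continuous psis0)).
have G0 : (0 : E2) @[q --> G] --> (0 : E2) by exact: cvg_cst.
have D_near : {near G,
  (fun q => gderive (L psi) (q.2.1, psi (s q.1)) (q.2.2, 0)) =1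
  (fun q => gderive (F (s q.1)) q.2.1 q.2.2)}.
  have Gphi : \forall q \near G, (phi @` cdom phi) q.2.1.
    by apply: Gu; apply: open_nbhs_nbhs; split => //; exact: cran_open.
  have Gpsid : \forall q \near G, cdom psi (s q.1).
    by apply: Gs; apply: open_nbhs_nbhs; split => //; exact: cdom_open.
  apply: filterS2 Gphi Gpsid => q phiq psiq.
  exact/esym/gderiveE/is_gderive_slice.
apply: cvg_trans (near_eq_cvg D_near) _.
have Lc : {for ((u0, psi (s s0)), (v0, 0)),
    continuous (fun p => gderive (L psi) p.1 p.2)}.
  by apply: Lcont; split => //=; exists (s s0).
exact: (@cvg_comp _ _ _
  (fun q : S * (E1 * E1) => ((q.2.1, psi (s q.1)), (q.2.2, 0 : E2)))
  (fun p => gderive (L psi) p.1 p.2) G _ _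
  (cvg_pair (cvg_pair Gu Gpsi) (cvg_pair Gv G0)) Lc).
Qed.

Lemma partial_param_continuous (u v : E1) : (phi @` cdom phi) u ->
  continuous (fun t => D (s t) u v).
Proof.
move=> phiu t.
exact: (@cvg_comp _ _ _ (fun t => (t, (u, v))) (fun q => D (s q.1) q.2.1 q.2.2)
  (nbhs t) _ _ (cvg_pair cvg_id (cvg_cst (u, v))) (partial_continuous t u v phiu)).
Qed.

Hypothesis S_compact : compact [set: S].

(** The uniformity in the index is the tube lemma: the inequality holds near each
    [(t0, (u0, v0))], so by compactness it holds for all indices once the base
    point and the direction are close to [(u0, v0)]. *)
Lemma equi_partial (u0 v0 : E1) : (phi @` cdom phi) u0 ->
  equi_strict_gderive (fun t : S => F (s t)) u0 v0 (fun t => D (s t) u0 v0).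
Proof.
move=> phiu0; apply: (@equi_strict_gderive_C1 _ _ _ (fun t : S => F (s t))
  (fun t => D (s t))).
  have := cran_open phi; rewrite openE => /(_ _ phiu0).
  by apply: filterS => u phiu t w; exact: is_gderive_partial.
move=> eps eps0.
have /compact_near_coveringP near_S := S_compact.
have e2 : 0 < eps / 2 by rewrite divr_gt0.
have : \forall p \near (u0, v0), [set: S] `<=`
    (fun t => `|D (s t) p.1 p.2 - D (s t) u0 v0| <= eps).
  apply: (near_S _ (nbhs (u0, v0))
    (fun p t => `|D (s t) p.1 p.2 - D (s t) u0 v0| <= eps)) => t0 _.
  have joint := partial_continuous t0 u0 v0 phiu0.
  have param := partial_param_continuous u0 v0 phiu0 t0.
  have joint_near : \forall q \near (t0, (u0, v0)),
      `|D (s t0) u0 v0 - D (s q.1) q.2.1 q.2.2| <= eps / 2.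
    exact: (cvgrPdist_le _ _).1 joint _ e2.
  have param_near : \forall q \near (t0, (u0, v0)),
      `|D (s t0) u0 v0 - D (s q.1) u0 v0| <= eps / 2.
    exact: cvg_fst ((cvgrPdist_le _ _).1 param _ e2).
  apply: filterS2 joint_near param_near => -[t p]/= tp t0p.
  rewrite (splitr eps) -[X in `|X|](subrKA (D (s t0) u0 v0)).
  by rewrite (le_trans (ler_normD _ _))// distrC lerD.
by apply: filterS => p Sp t; exact: Sp.
Qed.

End partial_differential.

(** * Covectors and minima on a submanifold *)

Section strict_cotangent.
Context {R : realType} {E : tvsType R}.

Lemma strict_gderive_has_differential {M : manifold E} {f : M -> R} {x : M}
    {d : E -> R} :
  (forall v, strict_gderive (f \o cinv (chart_at x)) (chart_at x x) v (d v)) ->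
  has_differential f x /\ forall v : tangent x, differential f v = d v.
Proof.
move=> fd.
have fd' v := strict_gderive_is_gderive (fd v).
have dE : differential f (x := x) = d :> (tangent x -> R).
  by apply/funext => v; exact: gderiveE (fd' v).
split; last by rewrite dE.
split=> [v|]; first by exists (d v); exact: fd'.
rewrite dE; split=> [c v w|]; last exact: strict_gderive_continuous fd.
exact: is_gderive_unique (fd' _) (strict_gderive_linear c (fd v) (fd w)).
Qed.

(** A line through [g] in a chart of [G] becomes a curve in the chart [phi] whose
    velocity at time 0 is the given tangent vector of [G]; along it [f] is minimal
    at time 0. *)
Lemma strict_gderive_min_conormal {M : manifold E} {n : nat}
    {G : compact_submanifold M n} {f : M -> R} {g : G} {d : E -> R} :
  let phi := chart_at (sub_incl g) in
  (forall v, strict_gderive (f \o cinv phi) (phi (sub_incl g)) v (d v)) ->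
  (forall g' : G, f (sub_incl g) <= f (sub_incl g')) ->
  conormal (differential f (x := sub_incl g)).
Proof.
move=> phi fd fmin.
have [[_ fcot] dE] := strict_gderive_has_differential fd.
split => // _ [v _ <-]; rewrite dE.
have [incl_cont incl_smooth] := sub_incl_smooth G.
pose chi := chart_at g; pose c := phi \o sub_incl (c := G) \o cinv chi.
have chig : cinv chi (chi g) = g by apply: cmapK; exact: chart_at_dom.
have phig : cdom phi (sub_incl g) := chart_at_dom _.
have cg : c (chi g) = phi (sub_incl g) by rewrite /c /= chig.
have cv : is_gderive c (chi g) v (mdiff (@sub_incl _ _ _ _ G) (x := g) v).
  have [_ cder _] := incl_smooth _ _ (chart_at_atlas g)
    (chart_at_atlas (sub_incl g)) 1%N.
  apply: (@xgetPex _ _ [set df | is_gderive c (chi g) v df]).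
  apply: cder; exists g => //; split; exact: chart_at_dom.
(* [c] represents the curve in [M] only while the latter stays in the domain of
   [phi], which it does for small times *)
apply: is_gderive_min (strict_gderive_comp cg (fd _) cv) _.
have cphi : \forall h \near (0 : R),
    cdom phi (sub_incl (cinv chi (chi g + h *: v))).
  have cinvg : cinv chi (chi g + h *: v) @[h --> (0 : R)] --> g.
    have := cvg_comp _ _ (cvg_line (chi g) v) (cinv_continuous (chart_at_dom g)).
    by rewrite chig.
  have inclg := cvg_comp _ _ cinvg (incl_cont g).
  by apply: inclg; apply: open_nbhs_nbhs; split => //; exact: cdom_open.
apply: filterS cphi => h ch.
change (f (cinv phi (c (chi g))) <=
  f (cinv phi (phi (sub_incl (cinv chi (chi g + h *: v)))))).
by rewrite cg !cmapK.
Qed.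

End strict_cotangent.

(** * The posterior density *)

Section posterior.
Context {R : realType} {p q n k : nat}.
Context {Theta : fd_manifold R p} {Lambda : fd_manifold R q} {E : tvsType R}.
Context {C : mapping_manifold Theta Lambda E}.
Context {G : compact_submanifold C n} {dg : volume_form G}.
Context {f : borel Lambda -> borel Lambda -> R} {lambda : borel G -> R}.
Context {theta : 'I_k -> Theta} {y : 'I_k -> Lambda}.
Hypothesis f_meas : measurable_fun setT
  (fun z : borel Lambda * borel Lambda => f z.1 z.2).
Hypothesis f_ge0 : forall a b, 0 <= f a b.
Hypothesis lambda_meas : measurable_fun setT lambda.
Hypothesis lambda_ge0 : forall g, 0 <= lambda g.

(** By the exponential law, applied to the inclusion of [G], the evaluation is
    smooth in the point of [G] and the point of [Theta] together. *)
Lemma evaluation_continuous (t : Theta) :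
  continuous (fun g : G => mm_ev (sub_incl g) t).
Proof.
have [/(_ (sub_incl_smooth G))[ev_cont _] _] :=
  mm_exponential_law (@sub_incl _ _ _ _ G).
move=> g.
exact: (@cvg_comp _ _ _ (fun g : G => (g, t))
  (fun z : G * Theta => mm_ev (sub_incl z.1) z.2) (nbhs g) _ _
  (cvg_pair cvg_id (cvg_cst t)) (ev_cont (g, t))).
Qed.

Lemma likelihood_ge0 (g : G) : 0 <= likelihood f theta y g.
Proof. by apply: prodr_ge0 => i _. Qed.

Lemma likelihood_measurable :
  measurable_fun setT (likelihood (G := G) f theta y : borel G -> R).
Proof.
apply: measurable_prod => i _.
apply: (@measurableT_comp _ _ _ (borel G) (borel Lambda) R (f (y i))
  setT (fun g => mm_ev (sub_incl g) (theta i))).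
  exact: measurable_fun_pair2 f_meas.
by apply: continuous_borel; exact: evaluation_continuous.
Qed.

Lemma posterior_ge0 (g : G) : 0 <= posterior dg f theta lambda y g.
Proof.
rewrite /posterior divr_ge0 ?mulr_ge0 ?likelihood_ge0//.
apply: fine_ge0; apply: integral_ge0 => h _.
by rewrite lee_fin mulr_ge0 ?likelihood_ge0.
Qed.

Lemma posterior_integrable :
  (marginal dg f theta lambda y < +oo)%E ->
  (vmeasure dg).-integrable setT
    (fun g => (posterior dg f theta lambda y g)%:E).
Proof.
move=> mu_fin.
have num_int : (vmeasure dg).-integrable setT
    (fun g => (likelihood f theta y g * lambda g)%:E).
  apply/integrableP; split.
    apply/measurable_EFinP.
    by apply: measurable_funM => //; exact: likelihood_measurable.
  under eq_integral => g _ do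
    rewrite gee0_abs ?lee_fin ?mulr_ge0 ?likelihood_ge0//.
  exact: mu_fin.
have := integrableZr measurableT (fine (marginal dg f theta lambda y))^-1 num_int.
by [].
Qed.

End posterior.

(** * Differentiation of the posterior risk *)

Theorem proposition3p11 (R : realType) (p q n k : nat)
  (Theta : fd_manifold R p) (Lambda : fd_manifold R q) (E : tvsType R)
  (C : mapping_manifold Theta Lambda E)
  (G : compact_submanifold C n) (dg : volume_form G)
  (dy : {measure set (borel Lambda) -> \bar R})
  (f : borel Lambda -> borel Lambda -> R) (hf : conditional_density dy f)
  (lambda : borel G -> R) (hlambda : probability_density (vmeasure dg) lambda)
  (theta : 'I_k -> Theta) (y : 'I_k -> Lambda)
  (hmu : (0 < marginal dg f theta lambda y < +oo)%E)
  (l : C -> C -> R) (hl : loss_function l) (hl_smooth : smooth_fun2 l) :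
  let post : borel G -> R := posterior dg f theta lambda y in
  let risk : C -> R := posterior_risk dg f theta lambda l y in
  (forall gh : C,
     [/\ (vmeasure dg).-integrable setT
           (fun g => (l gh (sub_incl g) * post g)%:E),
         has_differential risk gh,
         forall X : tangent gh,
           (vmeasure dg).-integrable setT
             (fun g => (differential (l^~ (sub_incl g)) X * post g)%:E)
       & forall X : tangent gh,
           differential risk X =
           \int[vmeasure dg]_g (differential (l^~ (sub_incl g)) X * post g)]) /\
  (forall gh : G, bayesian_estimate dg f theta lambda l y gh ->
     conormal (differential risk (x := sub_incl gh))).
Proof.
move=> post risk.
have [f_meas f_ge0 _] := hf; have [lambda_meas lambda_ge0 _] := hlambda.
have /andP[_ mu_fin] := hmu.
have post_int : (vmeasure dg).-integrable setT (fun g => (post g)%:E).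
  exact: posterior_integrable f_meas f_ge0 lambda_meas lambda_ge0 mu_fin.
have post_ge0 g : 0 <= post g by exact: posterior_ge0 f_ge0 lambda_ge0 g.
have G_compact : compact [set: G] by exact: sub_compact.
have incl_cont : continuous (@sub_incl _ _ _ _ G) := (sub_incl_smooth G).1.
have loss_cont gh : continuous (fun g : G => l gh (sub_incl g)).
  move=> g.
  exact: (@cvg_comp _ _ _ (fun g : G => (gh, sub_incl g))
    (fun z => l z.1 z.2) (nbhs g) _ _
    (cvg_pair (cvg_cst gh) (incl_cont g)) (hl_smooth.1 (gh, sub_incl g))).
have chart_gh (gh : C) : (chart_at gh @` cdom (chart_at gh)) (chart_at gh gh).
  by exists gh => //; exact: chart_at_dom.
have dloss_cont gh (X : tangent gh) :
    continuous (fun g : G => differential (l^~ (sub_incl g)) X).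
  exact: (partial_param_continuous hl_smooth (chart_at_atlas gh) incl_cont
    _ _ (chart_gh gh)).
have risk_strict gh (X : tangent gh) :
    strict_gderive (risk \o cinv (chart_at gh)) (chart_at gh gh) X
      (\int[vmeasure dg]_g (differential (l^~ (sub_incl g)) X * post g)).
  apply: (Rintegral_strict_gderive G_compact post_int post_ge0 _
    (dloss_cont gh X)); first by move=> u; exact: loss_cont.
  exact: (equi_partial hl_smooth (chart_at_atlas gh) incl_cont G_compact
    _ _ (chart_gh gh)).
split=> [gh|gh gh_min].
  have [risk_diff riskE] := strict_gderive_has_differential (risk_strict gh).
  split => //; first exact: integrable_continuousM.
  by move=> X; exact: integrable_continuousM.
exact: (strict_gderive_min_conormal (risk_strict (sub_incl gh)) gh_min).
Qed.
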